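(* Let $\mathcal{X}$ be a discrete-time birth-death process on $S=\{0,1,2,\dots\}$ with birth, death and self-transition probabilities $p_i>0$, $q_{i+1}>0$, $r_i\ge 0$ ($i\ge 0$), where $q_0=0$, $p_i+q_i+r_i=1$ for all $i\ge 0$, and $r_i>0$ for at least one $i$. Let $\pi_0:=1$ and $\pi_n:=\frac{p_0p_1\cdots p_{n-1}}{q_1q_2\cdots q_n}$ for $n\ge1$. Then $\mathcal{X}$ is asymptotically aperiodic if and only if \[ \sum_{j=0}^\infty \frac{1}{p_j\pi_j}\sum_{k=0}^j r_k\pi_k=\infty . \]
   Context: The birth-death process $\mathcal{X}=\{X(n),\,n=0,1,\dots\}$ is the homogeneous Markov chain on $S=\{0,1,2,\dots\}$ with 1-step transition probabilities $P(i,i+1)=p_i$, $P(i+1,i)=q_{i+1}$, $P(i,i)=r_i$ ($i\ge0$) and all others zero; it is stochastic, irreducible and aperiodic. The initial distribution is arbitrary and $\mathbb{P}$ is the induced probability measure on sample paths. For $m\ge 1$, $\mathcal{X}^{(m)}=\{X^{(m)}(n)=X(nm),\ n=0,1,\dots\}$ is the $m$-step chain. For a Markov chain $\mathcal{Y}=\{Y(n)\}$ on $S$ (here $\mathcal{X}$ or some $\mathcal{X}^{(m)}$) and $C\subset S$ let $U(C)=\{Y(n)\in C \text{ for infinitely many } n\}$ and $L(C)=\{Y(n)\in C\text{ for all sufficiently large }n\}$. $C$ is transient (w.r.t. $\mathcal{Y}$) if $\mathbb{P}(U(C))=0$; regular if $\mathbb{P}(U(C)\setminus L(C))=0$; almost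 closed if it is regular and not transient. These notions do not depend on the initial distribution. An almost closed set is atomic if it does not contain two disjoint almost closed subsets, and nonatomic otherwise. Two regular sets are equivalent if their symmetric difference is transient. A Blackwell decomposition of $S$ for $\mathcal{Y}$ is a finite or countable collection $\{C_1,C_2,\dots\}$ of disjoint almost closed sets such that (i) every $C_i$, except at most one, is atomic; (ii) the nonatomic $C_i$, if present, contains no atomic subsets and consists of transient states; (iii) $\sum_i\mathbb{P}(L(C_i))=1$. By a theorem of Blackwell such a decomposition exists and is unique up to equivalence; $\beta(\mathcal{Y})$ denotes the number of sets in it. $\mathcal{Y}$ is simple if $\beta(\mathcal{Y})=1$. (A birth-death process on $S=\{0,1,2,\dots\}$ with birth, death and self-transition probabilities $p_i>0$, $q_{i+1}>0$, $r_i\ge 0$ ($i\ge 0$), where $q_0=0$, $p_i+q_i+r_i=1$ for all $i\ge 0$, and $r_i>0$ for at least one $i$, is simple.) The asymptotic period of a simple chain $\mathcal{X}$ is $d(\mathcal{X}):=\sup\{m\ge1 : \beta(\mathcal{X}^{(m)})=m\}\in\{1,2,\dots\}\cup\{\infty\}$; $\mathcal{X}$ is asymptotically aperiodic if $d(\mathcal{X})=1$. *)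

(* Defs.v *)
From HB Require Import structures.
From mathcomp Require Import all_boot all_order all_algebra.
From mathcomp Require Import all_classical all_reals all_analysis.

Set Implicit Arguments.
Unset Strict Implicit.
Unset Printing Implicit Defensive.

Import Order.TTheory GRing.Theory Num.Theory.
Import numFieldNormedType.Exports.

Local Open Scope classical_set_scope.
Local Open Scope ring_scope.

Section Blackwell.
Context {d : measure_display} {T : measurableType d} {R : realType}
  {P : probability T R}.
Implicit Types (Y : nat -> {RV P >-> nat}) (C A B : set nat).

(* The initial distribution, i.e. the law of [Y 0], is unconstrained.  The
   product form of the Markov property avoids conditioning on null events. *)
Definition markov_chain (K : nat -> nat -> R) Y : Prop :=
  forall (n : nat) (x : nat -> nat),
    P [set w | forall k, (k <= n.+1)%N -> Y k w = x k] =
    (P [set w | forall k, (k <= n)%N -> Y k w = x k] * (K (x n) (x n.+1))%:E)%E.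

Definition m_step (m : nat) Y : nat -> {RV P >-> nat} := fun n => Y (n * m)%N.

Definition U Y C : set T := [set w | infinite_set [set n | C (Y n w)]].

Definition L Y C : set T := [set w | \forall n \near \oo, C (Y n w)].

Definition transient Y C : Prop := P (U Y C) = 0%E.

Definition regular Y C : Prop := P (U Y C `\` L Y C) = 0%E.

Definition almost_closed Y C : Prop := regular Y C /\ ~ transient Y C.

Definition has_disjoint_almost_closed Y C : Prop :=
  exists A B, [/\ A `<=` C, B `<=` C, A `&` B = set0,
                  almost_closed Y A & almost_closed Y B].

Definition atomic Y C : Prop :=
  almost_closed Y C /\ ~ has_disjoint_almost_closed Y C.

Definition nonatomic Y C : Prop :=
  almost_closed Y C /\ has_disjoint_almost_closed Y C.

(* A state is transient when almost surely it is visited only finitely often. *)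
Definition transient_state Y (i : nat) : Prop := transient Y [set i].

Definition blackwell_decomposition Y (D : set (set nat)) : Prop :=
  [/\ countable D /\ trivIset D id,
      forall C, D C -> almost_closed Y C,
      forall C C', D C -> D C' -> nonatomic Y C -> nonatomic Y C' -> C = C',
      forall C, D C -> nonatomic Y C ->
        (forall A, A `<=` C -> ~ atomic Y A) /\
        (forall i, C i -> transient_state Y i)
    & (\esum_(C in D) P (L Y C) = 1)%E].

(* For a Markov chain, Blackwell's theorem says that a decomposition exists and
   that the number of its sets does not depend on it, so the set below is a
   singleton; the default value 0 is irrelevant. *)
Definition beta Y : \bar R :=
  xget 0%E [set counting D | D in blackwell_decomposition Y].

Definition asymptotic_period Y : \bar R :=
  ereal_sup [set m%:R%:E | m in
    [set m : nat | (1 <= m)%N /\ beta (m_step m Y) = m%:R%:E]].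

Definition asymptotically_aperiodic Y : Prop := asymptotic_period Y = 1%E.

End Blackwell.

Section BirthDeath.
Context {R : realType}.
Implicit Types p q r : nat -> R.

Definition bd_kernel p q r (i j : nat) : R :=
  if j == i.+1 then p i
  else if i == j.+1 then q i
  else if i == j then r i
  else 0.

Definition bd_pi p q (n : nat) : R :=
  (\prod_(0 <= i < n) p i) / (\prod_(1 <= i < n.+1) q i).

End BirthDeath.

(* Main.v *)
(* Write [K f i = p i * f (i+1) + r i * f i + q i * f (i-1)], and let [pot n] be
   the n-th partial sum of the series, so that [K pot = pot + r].

   A regular set [C] of the m-step chain is described by the bounded function
   [h = lim_N K^(N m) 1_C], which satisfies [K^m h = h], and disjoint almost
   closed sets give linearly independent functions.  As [h] is determined by
   [h 0, K h 0, ..., K^(m-1) h 0], there are at most [m] of them.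

   If the series diverges, consider the energy [W i = \sum_(n < m) (K^n h i)^2].
   Since [K^m h = h], Jensen's inequality with its variance term gives
   [K W >= W + r Z], where [Z] is the energy of [K h - h], itself nondecreasing
   in [i]; comparison with [pot] yields [W n >= W 0 + Z 0 * pot n].  Boundedness
   of [W] forces [Z 0 = 0], hence [h] is determined by [h 0], and every m-step
   chain has exactly one almost closed set up to equivalence.

   If the series converges, [K pot = pot + r] with [pot] bounded shows that the
   expected number of self-transitions is finite, so by Borel-Cantelli the
   parity of [X n] eventually alternates: the even and the odd states are then disjoint
   almost closed sets of the 2-step chain, which has at most two of them. *)

Require Import Defs.
From HB Require Import structures.
From mathcomp Require Import all_boot all_order all_algebra.
From mathcomp Require Import all_classical all_reals all_analysis.
From mathcomp Require finmap.
From mathcomp Require Import ring lra zify.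

Set Implicit Arguments.
Unset Strict Implicit.
Unset Printing Implicit Defensive.

Import Order.TTheory GRing.Theory Num.Theory.
Import numFieldNormedType.Exports.

Local Open Scope classical_set_scope.
Local Open Scope ring_scope.

(** * Probabilities of tail events *)

Section Probability.
Context {d : measure_display} {T : measurableType d} {R : realType}
  {P : probability T R}.
Implicit Types A B F : set T.

Definition prob (P : probability T R) A : R := fine (P A).

Lemma probE A : measurable A -> P A = (prob P A)%:E.
Proof. by move=> mA; rewrite /prob fineK// fin_num_measure. Qed.

Lemma prob_ge0 A : 0 <= prob P A.
Proof. by rewrite fine_ge0. Qed.

Lemma le_prob A B : measurable A -> measurable B -> A `<=` B ->
  prob P A <= prob P B.
Proof.
by move=> mA mB AB; rewrite -lee_fin -!probE// le_measure ?inE.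
Qed.

Lemma prob_setT : prob P setT = 1.
Proof. by rewrite /prob probability_setT. Qed.

Lemma prob_set0 : prob P set0 = 0.
Proof. by rewrite /prob measure0. Qed.

Lemma probID A B : measurable A -> measurable B ->
  prob P A = prob P (A `&` B) + prob P (A `\` B).
Proof.
move=> mA mB; apply: EFin_inj; rewrite EFinD -!probE//.
- by rewrite (measureDI P mA mB) addeC.
- exact: measurableD.
- exact: measurableI.
Qed.

Lemma prob_eq0 A : measurable A -> (prob P A = 0) <-> (P A = 0%E).
Proof.
by move=> mA; rewrite (probE mA); split=> [->//|h]; exact: EFin_inj.
Qed.

Lemma prob_setI_null A B : measurable A -> measurable B ->
  prob P A = 0 -> prob P (B `&` A) = 0.
Proof.
move=> mA mB A0; apply/eqP; rewrite eq_le prob_ge0 andbT -A0 le_prob//.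
exact: measurableI.
Qed.

Implicit Types (Y : nat -> {RV P >-> nat}) (C D : set nat).

Definition hits Y C n : set T := [set w | C (Y n w)].

Lemma measurable_hits Y C n : measurable (hits Y C n).
Proof. exact: (measurable_funPTI (Y n)). Qed.
Hint Resolve measurable_hits : core.

Lemma L_bigcup Y C : L Y C = \bigcup_N \bigcap_(n >= N) hits Y C n.
Proof.
apply/seteqP; split=> w [N _ CN].
  by exists N => // n /= Nn; exact: CN.
by exists N => // n /= Nn; exact: CN.
Qed.

Lemma U_lim_sup Y C : U Y C = lim_sup_set (hits Y C).
Proof.
apply/seteqP; split=> w => [infY N _|Uw].
  apply: contrapT => noN; apply: infY.
  apply: (@sub_finite_set _ _ `I_N); last exact: finite_II.
  move=> n /= Cn; rewrite ltnNge; apply/negP => Nn; apply: noN.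
  by exists n.
move=> /finite_seqP[S SE]; have [n /= Sn Cn] := Uw (\max_(i <- S) i).+1 I.
have : n \in S by have : [set` S] n by rewrite -SE.
by move=> nS; have := @leq_bigmax_seq _ S xpredT id n nS isT; rewrite leqNgt Sn.
Qed.

Lemma measurable_L Y C : measurable (L Y C).
Proof.
rewrite L_bigcup; apply: bigcupT_measurable => N.
by apply: bigcap_measurableType => n _.
Qed.

Lemma measurable_U Y C : measurable (U Y C).
Proof.
rewrite U_lim_sup; apply: bigcap_measurableType => N _.
by apply: bigcup_measurable.
Qed.
Hint Resolve measurable_L measurable_U : core.

Lemma L_sub_U Y C : L Y C `<=` U Y C.
Proof.
rewrite L_bigcup U_lim_sup => w [N _ CN] M _.
by exists (maxn M N); [exact: leq_maxl|apply: CN; exact: leq_maxr].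
Qed.

(** The event is squeezed between the intersection and the union of the hits from time [N] on. By
    continuity of the measure their probabilities tend to those of [F] met with [L Y C] and with
    [U Y C], which agree by regularity. *)
Lemma cvg_prob_hits Y C F : measurable F -> regular Y C ->
  prob P (F `&` hits Y C N) @[N --> \oo] --> prob P (F `&` L Y C).
Proof.
move=> mF regC.
have mlow N : measurable (F `&` \bigcap_(n >= N) hits Y C n).
  by apply: measurableI => //; apply: bigcap_measurableType => n _.
have mupp N : measurable (F `&` \bigcup_(n >= N) hits Y C n).
  by apply: measurableI => //; apply: bigcup_measurable.
have low : prob P (F `&` \bigcap_(n >= N) hits Y C n) @[N --> \oo] -->
    prob P (F `&` L Y C).
  apply: fine_cvg; rewrite -probE; last exact: measurableI.
  rewrite L_bigcup setI_bigcupr.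
  apply: nondecreasing_cvg_mu => //.
    by apply: bigcupT_measurable.
  move=> m n mn; apply/subsetPset => w [Fw Cw]; split=> // k /= nk.
  by apply: Cw; exact: leq_trans nk.
have upp : prob P (F `&` \bigcup_(n >= N) hits Y C n) @[N --> \oo] -->
    prob P (F `&` U Y C).
  apply: fine_cvg; rewrite -probE; last exact: measurableI.
  rewrite U_lim_sup /lim_sup_set -bigcapIr//.
  apply: nonincreasing_cvg_mu => //.
  - by rewrite -ge0_fin_numE//; exact: fin_num_measure.
  - by apply: bigcap_measurableType => n _.
  - move=> m n mn; apply/subsetPset => w [Fw [k /= nk Ck]]; split=> //.
    by exists k => //=; exact: leq_trans nk.
have UL : prob P (F `&` U Y C) = prob P (F `&` L Y C).
  rewrite (@probID (F `&` U Y C) (L Y C))//; last exact: measurableI.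
  rewrite -setIA (setIidr (@L_sub_U Y C)) -setIDA.
  rewrite [X in _ + X]prob_setI_null ?addr0//.
    exact: measurableD.
  by apply/prob_eq0 => //; exact: measurableD.
rewrite UL in upp.
apply: (squeeze_cvgr _ low upp); apply: nearW => N; apply/andP; split.
  apply: le_prob => //; first exact: measurableI.
  by move=> w [Fw Cw]; split=> //; apply: Cw => /=.
apply: le_prob => //; first exact: measurableI.
by move=> w [Fw Cw]; split=> //; exists N => /=.
Qed.

Lemma transient_L Y C : regular Y C -> transient Y C <-> prob P (L Y C) = 0.
Proof.
move=> regC.
have {}regC : prob P (U Y C `\` L Y C) = 0.
  by apply/prob_eq0 => //; exact: measurableD.
rewrite /transient -prob_eq0// (@probID (U Y C) (L Y C))// regC addr0.
by rewrite (setIidr (@L_sub_U Y C)).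
Qed.

Lemma L_disjoint Y C D : C `&` D = set0 -> L Y C `&` L Y D = set0.
Proof.
move=> CD; rewrite -subset0 => w [[N _ CN] [M _ DM]].
suff : (C `&` D) (Y (maxn N M) w) by rewrite CD.
by split; [apply: CN; exact: leq_maxl|apply: DM; exact: leq_maxr].
Qed.

End Probability.

#[global] Hint Extern 0 (measurable (hits _ _ _)) =>
  solve [apply: measurable_hits] : core.
#[global] Hint Extern 0 (measurable (L _ _)) =>
  solve [apply: measurable_L] : core.
#[global] Hint Extern 0 (measurable (U _ _)) =>
  solve [apply: measurable_U] : core.

(** * Counting the sets of a Blackwell decomposition *)

Section BlackwellCount.
Context {d : measure_display} {T : measurableType d} {R : realType}
  {P : probability T R}.
Context {Y : nat -> {RV P >-> nat}}.
Implicit Types (A B C : set nat) (D : set (set nat)).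

Lemma decomposition_nonempty D : blackwell_decomposition Y D -> D !=set0.
Proof.
move=> [_ _ _ _ sum1]; apply/set0P/eqP => D0; move: sum1.
by rewrite D0 esum_set0 => /esym/eqP; rewrite onee_eq0.
Qed.

Lemma decomposition_disjoint D A B : blackwell_decomposition Y D ->
  D A -> D B -> A <> B -> A `&` B = set0.
Proof.
move=> [[_ tD] _ _ _ _] DA DB AB; apply: contrapT => /eqP/set0P.
by move=> /(tD A B DA DB).
Qed.

Lemma almost_closed_neq0 A : almost_closed Y A -> A !=set0.
Proof.
move=> [_ trA]; apply/set0P/eqP => A0; apply: trA; rewrite A0.
rewrite /transient (_ : U Y set0 = set0) ?measure0//.
by rewrite -subset0 => w /infinite_setN0[].
Qed.

(** [beta] takes its value from an unspecified decomposition, so one must exist and all must have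
    the same cardinality. *)
Lemma beta_eq D k : blackwell_decomposition Y D ->
  (forall D', blackwell_decomposition Y D' -> counting D' = k :> \bar R) ->
  beta Y = k.
Proof.
move=> dD Dk; apply: xget_unique => [|_ [D' dD' <-]]; last exact: Dk.
by exists D => //; exact: Dk.
Qed.

Lemma almost_closed_setT : almost_closed Y setT.
Proof.
have LT : L Y setT = setT by apply/seteqP; split=> // w _; exact: nearW.
have UT : U Y setT = setT.
  by apply/seteqP; split=> // w _; apply: L_sub_U; rewrite LT.
rewrite /almost_closed /regular /transient LT UT setDv measure0; split=> //.
by rewrite probability_setT => /eqP; rewrite onee_eq0.
Qed.

Lemma regularI A B : regular Y A -> regular Y B -> regular Y (A `&` B).
Proof.
have mUL C : measurable (U Y C `\` L Y C) by exact: measurableD.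
move=> /negligibleP-/(_ (mUL _)) nA /negligibleP-/(_ (mUL _)) nB.
apply/negligibleP; first exact: mUL.
apply: (negligibleS _ (negligibleU nA nB)) => w [UAB LAB].
have UA : U Y A w by apply: sub_infinite_set UAB => n [].
have UB : U Y B w by apply: sub_infinite_set UAB => n [].
have [LA|] := pselect (L Y A w); last by left.
have [LB|] := pselect (L Y B w); last by right.
by case: LAB; apply: filterS2 LA LB.
Qed.

(** As the chain almost surely ends up in [A], the events [L Y B] and [L Y (A]&[B)] differ by a null
    event. *)
Lemma almost_closedI A B : almost_closed Y A -> almost_closed Y B ->
  P (L Y A) = 1%E -> almost_closed Y (A `&` B).
Proof.
move=> [rA _] [rB nB] LA; have rAB := regularI rA rB; split=> //.
move=> /(transient_L rAB) LAB; apply: nB; apply/(transient_L rB).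
have mLA : measurable (~` L Y A) by exact: measurableC.
rewrite (@probID _ _ _ P _ (L Y A))// [X in X + _](_ : _ = 0) ?add0r.
  apply: prob_setI_null => //; apply/prob_eq0 => //.
  by rewrite probability_setC// LA subee.
apply/eqP; rewrite eq_le prob_ge0 andbT -LAB le_prob//.
  exact: measurableI.
by move=> w [LB LAw]; apply: filterS2 LAw LB.
Qed.

(** The whole space is then a single atomic set, and a decomposition has no room for a second
    one. *)
Lemma beta_eq1 :
  (forall A B, almost_closed Y A -> almost_closed Y B -> A `&` B <> set0) ->
  beta Y = 1%E.
Proof.
move=> nodis.
have nononat A : ~ nonatomic Y A.
  by move=> [_ [B [C [_ _ BC acB acC]]]]; exact: nodis BC.
apply: (@beta_eq [set setT]) => [|D dD].
  split.
  - split; first exact: countable1.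
    by move=> A B -> ->.
  - by move=> _ ->; exact: almost_closed_setT.
  - by move=> A B -> ->.
  - by move=> A _ /nononat.
  - rewrite esum_set1//; rewrite (_ : L Y setT = setT) ?probability_setT//.
    by apply/seteqP; split=> // w _; exact: nearW.
have [C DC] := decomposition_nonempty dD.
have acD A : D A -> almost_closed Y A by case: dD => _ + _ _ _; exact.
suff -> : D = [set C].
  by rewrite /counting asboolT ?fset_set1 ?finmap.cardfs1//; exact: finite_set1.
apply/seteqP; split=> [A DA|_ -> //].
apply: contrapT => AC; apply: (nodis A C); [exact: acD|exact: acD|].
exact: (decomposition_disjoint dD).
Qed.

(** Splitting [A] or [B] would produce three disjoint almost closed sets, so both are atomic and
    form a decomposition. Every other decomposition has at most two sets for the same reason. *)
Lemma beta_eq2 A B : almost_closed Y A -> almost_closed Y B ->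
  A `&` B = set0 -> (P (L Y A) + P (L Y B) = 1)%E ->
  (forall C1 C2 C3, almost_closed Y C1 -> almost_closed Y C2 ->
    almost_closed Y C3 -> C1 `&` C2 = set0 -> C1 `&` C3 = set0 ->
    C2 `&` C3 = set0 -> False) ->
  beta Y = 2%:E.
Proof.
move=> acA acB AB LAB no3.
have disS C1 C2 B1 B2 : B1 `<=` C1 -> B2 `<=` C2 -> C1 `&` C2 = set0 ->
    B1 `&` B2 = set0 :> set nat.
  by move=> s1 s2 C12; rewrite -subset0 -C12; exact: setISS.
have atom C C' : almost_closed Y C' -> C `&` C' = set0 ->
    ~ has_disjoint_almost_closed Y C.
  move=> acC' CC' [C1 [C2 [s1 s2 C12 ac1 ac2]]].
  by apply: (no3 C1 C2 C') => //; apply: disS CC'.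
have AneqB : A <> B.
  move=> E; have [i Ai] := almost_closed_neq0 acA.
  by have : (A `&` B) i by [rewrite -E]; rewrite AB.
have sum2 (C1 C2 : set nat) (f : set nat -> \bar R) : C1 <> C2 ->
    (forall C, 0 <= f C)%E ->
    (\esum_(C in [set C1; C2]) f C = f C1 + f C2)%E.
  move=> C12 f0; rewrite (esumID [set C1])//; congr (_ + _)%E.
    rewrite setIUl setIid (_ : [set C2] `&` _ = set0) ?setU0 ?esum_set1//.
    by rewrite -subset0 => C [-> /esym].
  rewrite setIUl setICr set0U (_ : _ `&` _ = [set C2]) ?esum_set1//.
  by apply/setIidl => C -> /esym.
apply: (@beta_eq [set A; B]) => [|D dD].
  have nonat C : [set A; B] C -> ~ nonatomic Y C.
    case=> -> [_]; first exact: (atom A B).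
    by apply: (atom B A) => //; rewrite setIC.
  split.
  - split; first exact: finite_set_countable.
    move=> C1 C2 [->|->] [->|->] //; last rewrite setIC;
      by rewrite AB => -[].
  - by move=> C [] ->.
  - by move=> C1 C2 /nonat.
  - by move=> C /nonat.
  - by rewrite sum2.
have [C1 DC1] := decomposition_nonempty dD.
have acD C : D C -> almost_closed Y C by case: dD => _ + _ _ _; exact.
have disD := decomposition_disjoint dD.
(* A single set [C1] would have [P (L Y C1) = 1], so its intersections with [A] and [B] would be
   disjoint and almost closed. Then [C1] would be nonatomic and yet contain the atomic set
   [C1]&[A]. *)
have [C2 [DC2 C21]] : exists C2, D C2 /\ C2 <> C1.
  apply: contrapT => /forallNP only.
  have DE : D = [set C1].
    apply/seteqP; split=> [C DC|_ -> //].
    by apply: contrapT => CC1; apply: (only C).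
  case: (dD) => _ _ _ nonat; rewrite DE esum_set1// => LC1.
  have ac1 := acD _ DC1.
  have acA1 := almost_closedI ac1 acA LC1.
  have acB1 := almost_closedI ac1 acB LC1.
  have [|+ _] := nonat C1 DC1.
    split=> //; exists (C1 `&` A), (C1 `&` B); split=> //; try exact: subIsetl.
    by apply: (disS A B) => //; exact: subIsetr.
  move=> /(_ (C1 `&` A) (@subIsetl _ _ _)); apply; split=> //.
  by apply: (atom _ (C1 `&` B)) => //; apply: (disS A B) => //; exact: subIsetr.
have -> : D = [set C1; C2].
  apply/seteqP; split=> [C DC|_ [->|->] //].
  apply: contrapT => /not_orP[n1 n2].
  apply: (no3 C1 C2 C); rewrite ?disD//; try exact: acD.
  - by move/esym.
  - by move/esym.
  - by move/esym.
rewrite /counting asboolT; last exact: finite_set2.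
rewrite fset_setU; [|exact: finite_set1|exact: finite_set1].
rewrite !fset_set1 finmap.cardfs2 (_ : C1 != C2)//.
by apply/eqP => /esym.
Qed.

End BlackwellCount.

(** * The birth-death operator and its periodic functions *)

Section BirthDeath.
Context {R : realType} {p q r : nat -> R}.
Implicit Types f g h : nat -> R.

(** At the origin [i.-1] is again [0]; the spurious term is cancelled by [q 0 = 0]. *)
Definition bd_op (p q r : nat -> R) f : nat -> R :=
  fun i => p i * f i.+1 + r i * f i + q i * f i.-1.

Local Notation K := (bd_op p q r).

Lemma iter_bd_op_sum (I : finType) (v : I -> R) (f : I -> nat -> R) n i :
  iter n K (fun j => \sum_k v k * f k j) i = \sum_k v k * iter n K (f k) i.
Proof.
elim: n i => [//|n IHn] i; rewrite iterS /bd_op !IHn !mulr_sumr -!big_split/=.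
by apply: eq_bigr => k _; rewrite /bd_op; ring.
Qed.

Lemma iter_bd_opD f g n i :
  iter n K (fun j => f j + g j) i = iter n K f i + iter n K g i.
Proof.
by elim: n i => [//|n IHn] i; rewrite !iterS /bd_op !IHn; ring.
Qed.

Lemma iter_bd_opB f g n i :
  iter n K (fun j => f j - g j) i = iter n K f i - iter n K g i.
Proof.
by elim: n i => [//|n IHn] i; rewrite !iterS /bd_op !IHn; ring.
Qed.

Lemma cvg_iter_bd_op (f : nat -> nat -> R) g :
  (forall i, f N i @[N --> \oo] --> g i) ->
  forall n i, iter n K (f N) i @[N --> \oo] --> iter n K g i.
Proof.
move=> fg; elim=> [|n IHn] i; first exact: fg.
by apply: cvgD; [apply: cvgD|]; apply: cvgMl_tmp; exact: IHn.
Qed.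

Context (p_gt0 : forall i, 0 < p i) (q0 : q 0%N = 0)
  (q_gt0 : forall i, 0 < q i.+1) (r_ge0 : forall i, 0 <= r i)
  (pqr1 : forall i, p i + q i + r i = 1).

Lemma q_ge0 i : 0 <= q i.
Proof. by case: i => [|i]; rewrite ?q0 // ltW. Qed.

Lemma iter_bd_op_cst c n i : iter n K (fun=> c) i = c.
Proof.
elim: n i => [//|n IHn] i.
by rewrite iterS /bd_op !IHn -!mulrDl addrAC pqr1 mul1r.
Qed.

Lemma le_iter_bd_op f g : (forall i, f i <= g i) ->
  forall n i, iter n K f i <= iter n K g i.
Proof.
move=> fg; elim=> [//|n IHn] i; rewrite !iterS /bd_op.
by rewrite !lerD// ler_wpM2l// ?q_ge0// ltW.
Qed.

(* The recurrence for [K ^ n.+1 g] at [i] yields [K ^ n g] at [i.+1]. *)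
Lemma iter_bd_op_origin g :
  (forall n, iter n K g 0%N = 0) -> forall i, g i = 0.
Proof.
move=> g0 k; suff gi i j n : (j <= i)%N -> iter n K g j = 0.
  exact: (gi k k 0%N).
elim: i j n => [|i IHi] j n; first by rewrite leqn0 => /eqP ->.
rewrite leq_eqVlt => /predU1P[->|]; last exact: IHi.
have := IHi i n.+1 (leqnn i); rewrite iterS /bd_op.
rewrite (IHi i)// (IHi i.-1) ?leq_pred//.
rewrite !mulr0 !addr0 => /eqP; rewrite mulf_eq0 gt_eqF//=.
by move=> /eqP.
Qed.

(** Subharmonicity reads [p i * (f (i+1) - f i) >= q i * (f i - f (i-1))], so the sign of the
    increments propagates upwards, starting from [q 0 = 0]. *)
Lemma subharmonic_nondecreasing f :
  (forall i, f i <= K f i) -> forall i, f i <= f i.+1.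
Proof.
move=> sub; elim=> [|i IHi].
  move: (sub 0%N) (pqr1 0%N) (p_gt0 0%N); rewrite /bd_op/= q0 => h1 h2 h3.
  rewrite -subr_ge0 -(pmulr_rge0 _ h3).
  have rE : r 0%N = 1 - p 0%N by lra.
  by move: h1; rewrite rE; lra.
move: (sub i.+1) (pqr1 i.+1) (p_gt0 i.+1) (q_gt0 i); rewrite /bd_op/=.
move: (p _) (q _) (r _) (f i.+1) (f i.+2) (f i) IHi.
move=> P Q S b c a ab h1 h2 h3 h4.
rewrite -subr_ge0 -(pmulr_rge0 _ h3).
have Qab : 0 <= Q * (b - a) by rewrite mulr_ge0 ?subr_ge0// ltW.
have SE : S = 1 - P - Q by lra.
by move: h1; rewrite SE; lra.
Qed.

(** * The potential, i.e. the partial sums of the series *)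

Definition bd_term (p q r : nat -> R) j : R :=
  (p j * bd_pi p q j)^-1 * \sum_(0 <= k < j.+1) r k * bd_pi p q k.

Definition bd_potential (p q r : nat -> R) n : R :=
  \sum_(0 <= j < n) bd_term p q r j.

Local Notation pot := (bd_potential p q r).

Lemma bd_pi_gt0 n : 0 < bd_pi p q n.
Proof.
by rewrite /bd_pi big_add1 divr_gt0// prodr_gt0.
Qed.

Lemma bd_piS n : bd_pi p q n.+1 * q n.+1 = bd_pi p q n * p n.
Proof.
rewrite /bd_pi [in LHS]big_nat_recr//= [X in _ / X * _]big_nat_recr//=.
have : \prod_(1 <= i < n.+1) q i != 0.
  by rewrite big_add1 prodf_seq_neq0; apply/allP => i _ /=; rewrite gt_eqF.
have := q_gt0 n; move: (q n.+1) => Q Q0 Q1.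
by field; rewrite Q1 gt_eqF.
Qed.

Lemma bd_term_ge0 j : 0 <= bd_term p q r j.
Proof.
apply: mulr_ge0; first by rewrite invr_ge0 ltW// mulr_gt0// bd_pi_gt0.
by apply: sumr_ge0 => k _; rewrite mulr_ge0// ltW// bd_pi_gt0.
Qed.

Lemma bd_potentialS n : pot n.+1 = pot n + bd_term p q r n.
Proof. by rewrite /bd_potential big_nat_recr. Qed.

(** With [t = bd_term p q r], the claim is [p i * t i - q i * t (i-1) = r i]. By the detailed
    balance [bd_piS] both products are sums of [r k * bd_pi p q k] divided by [bd_pi p q i], and
    only the term [k = i] survives. *)
Lemma bd_op_potential i : K pot i = pot i + r i.
Proof.
have piN : forall j, bd_pi p q j != 0 by move=> j; rewrite gt_eqF ?bd_pi_gt0.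
have sE : forall j, p j * bd_term p q r j =
    (bd_pi p q j)^-1 * \sum_(0 <= k < j.+1) r k * bd_pi p q k.
  by move=> j; rewrite /bd_term invfM !mulrA divff ?gt_eqF// mul1r.
rewrite /bd_op bd_potentialS mulrDr sE.
case: i => [|i]/=.
  have := pqr1 0%N; have := piN 0%N; rewrite big_nat1 q0.
  move: (bd_pi _ _ _) (pot _) => a b a0 e.
  rewrite mul0r addr0 mulrCA mulVf// mulr1.
  have -> : p 0%N = 1 - r 0%N by lra.
  by ring.
rewrite bd_potentialS big_nat_recr//=.
have := sE i; have := bd_piS i; have := pqr1 i.+1.
have := piN i; have := piN i.+1.
move: (\sum_(0 <= k < i.+1) r k * _) (pot i) (bd_term _ _ _ i).
move: (p i.+1) (q i.+1) (r i.+1) (bd_pi p q i.+1) (bd_pi p q i) (p i).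
move=> P Q S a b Pi s t u a0 b0 e1 e2 e3.
have -> : s = a * Q * u by rewrite e2 -mulrA e3 mulrA divff// mul1r.
have -> : P = 1 - Q - S by lra.
by field.
Qed.

(** The function [f - z * pot] is subharmonic, hence nondecreasing, so
    [f 0 + z * pot n <= f n <= B]. *)
Lemma potential_le f B z : 0 < z -> (forall i, f i <= B) ->
  (forall i, f i + z * r i <= K f i) -> forall n, pot n <= (B - f 0%N) / z.
Proof.
move=> z0 fB fr n; rewrite ler_pdivlMr// mulrC.
suff : forall n, f 0%N + z * pot n <= f n.
  by move=> /(_ n) h; have := fB n; lra.
suff mono : forall i, f i - z * pot i <= f i.+1 - z * pot i.+1.
  elim=> [|{}n IHn]; first by rewrite /bd_potential big_nil mulr0 addr0.
  by have := mono n; lra.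
apply: (@subharmonic_nondecreasing (fun i => f i - z * pot i)) => i.
have := fr i; have := bd_op_potential i; rewrite /bd_op/=.
move: (pot i.+1) (pot i) (pot i.-1) => a b c h1 h2.
have -> : p i * (f i.+1 - z * a) + r i * (f i - z * b) + q i * (f i.-1 - z * c)
  = p i * f i.+1 + r i * f i + q i * f i.-1 - z * (p i * a + r i * b + q i * c).
  by ring.
by rewrite h1; lra.
Qed.

(** The difference of [K (f ^ 2)] and [(K f) ^ 2] is the variance of [f] after one step; only its
    self-transition term is kept. *)
Lemma bd_op_sqr f i :
  K f i ^+ 2 + r i * (K f i - f i) ^+ 2 <= K (fun j => f j ^+ 2) i.
Proof.
set c := K f i; rewrite -subr_ge0.
have -> : K (fun j => f j ^+ 2) i - (c ^+ 2 + r i * (c - f i) ^+ 2) =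
    p i * (f i.+1 - c) ^+ 2 + q i * (f i.-1 - c) ^+ 2.
  rewrite /c /bd_op; have -> : p i = 1 - q i - r i by have := pqr1 i; lra.
  by ring.
by rewrite addr_ge0// mulr_ge0 ?sqr_ge0 ?q_ge0// ltW.
Qed.

(* For [f] fixed by [K ^ m], the squared norm of the m-periodic sequence
   [n |-> iter n K f i], which [K] shifts cyclically. *)
Definition energy f m i := \sum_(0 <= n < m) iter n K f i ^+ 2.

(** This is [bd_op_sqr] summed over one period; the cyclic shift leaves the sum of the squares
    unchanged. *)
Lemma bd_op_energy f m i : (forall j, iter m K f j = f j) ->
  energy f m i + r i * energy (fun j => K f j - f j) m i <= K (energy f m) i.
Proof.
move=> fm.
have -> : energy f m i = \sum_(0 <= n < m) iter n.+1 K f i ^+ 2.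
  apply/eqP; rewrite eq_sym -subr_eq0 -sumrB.
  by rewrite (telescope_sumr (fun n => iter n K f i ^+ 2))// fm subrr.
rewrite /energy mulr_sumr -big_split/= /bd_op !mulr_sumr -!big_split/=.
apply: ler_sum => n _; have := bd_op_sqr (iter n K f) i.
by rewrite iter_bd_opB -iterSr.
Qed.

Lemma periodic_harmonic_origin (m : nat) h B :
  (forall b, exists n, b < pot n) ->
  (forall i, `|h i| <= B) -> (forall i, iter m K h i = h i) ->
  forall n, (n < m)%N -> iter n.+1 K h 0%N = iter n K h 0%N.
Proof.
move=> potoo hB hm.
pose g j := K h j - h j.
have gm : forall i, iter m K g i = g i.
  by move=> i; rewrite iter_bd_opB -iterSr iterS hm /bd_op !hm.
have energy_ge0 f i : 0 <= energy f m i.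
  by rewrite sumr_ge0// => n _; rewrite sqr_ge0.
(* As [g] is also fixed by [K ^ m], its energy is subharmonic, hence least at the origin. *)
have g_mono : forall i, energy g m 0%N <= energy g m i.
  elim=> [//|i /le_trans]; apply.
  apply: subharmonic_nondecreasing => {}i.
  apply: le_trans (bd_op_energy i gm).
  by rewrite lerDl mulr_ge0.
have := energy_ge0 g 0%N; rewrite le_eqVlt => /predU1P[g0 n nm|g0].
  have {}g0 := esym g0; move/eqP: g0; rewrite psumr_eq0; last first.
    by move=> *; rewrite sqr_ge0.
  move=> /allP/(_ n); rewrite mem_index_iota/= nm => /(_ isT).
  by rewrite sqrf_eq0 iter_bd_opB -iterSr subr_eq0 => /eqP.
have h_bnd : forall i, energy h m i <= m%:R * B ^+ 2.
  move=> i; rewrite /energy.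
  apply: (@le_trans _ _ (\sum_(0 <= n < m) B ^+ 2)); last first.
    by rewrite sumr_const_nat subn0 mulr_natl.
  apply: ler_sum => n _; rewrite -real_normK ?num_real// lerXn2r ?nnegrE//.
    exact: le_trans (hB 0%N).
  have {}hB j : - B <= h j <= B by rewrite -ler_norml.
  rewrite ler_norml; apply/andP; split.
    rewrite -[leLHS](iter_bd_op_cst _ n i).
    by apply: le_iter_bd_op => j; have /andP[] := hB j.
  rewrite -[leRHS](iter_bd_op_cst _ n i).
  by apply: le_iter_bd_op => j; have /andP[] := hB j.
(* This is the bound that [potential_le] gives for [z = energy g m 0]; some [pot n] exceeds it. *)
have [n] := potoo ((m%:R * B ^+ 2 - energy h m 0%N) / energy g m 0%N).
rewrite ltNge (@potential_le (energy h m))// => i.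
apply: le_trans (bd_op_energy i hm).
by rewrite lerD2l mulrC ler_wpM2l.
Qed.

(** Periodicity reduces the exponents in [iter_bd_op_origin] modulo [m]. *)
Lemma periodic_harmonic_eq0 m h : (0 < m)%N ->
  (forall i, iter m K h i = h i) ->
  (forall n, (n < m)%N -> iter n K h 0%N = 0) -> forall i, h i = 0.
Proof.
move=> m0 /funext hm h0; apply: iter_bd_op_origin => n.
have hkm k : iter (k * m) K h = h.
  by elim: k => // k IHk; rewrite mulSn iterD IHk.
by rewrite (divn_eq n m) addnC iterD hkm h0// ltn_mod.
Qed.

Lemma bd_potential_ge0 n : 0 <= pot n.
Proof. by apply: sumr_ge0 => j _; exact: bd_term_ge0. Qed.

Lemma iter_bd_op_ge0 f n i : (forall j, 0 <= f j) -> 0 <= iter n K f i.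
Proof.
move=> f0; rewrite -[leLHS](iter_bd_op_cst 0 n i).
exact: le_iter_bd_op.
Qed.

Lemma iter_bd_op_r n i : iter n K r i = iter n.+1 K pot i - iter n K pot i.
Proof.
rewrite iterSr -iter_bd_opB; congr (iter n K _ i); apply/funext => j.
by rewrite bd_op_potential addrC addKr.
Qed.

(** * The birth-death chain *)

Context (r_pos : exists i, 0 < r i).
Context {d : measure_display} {T : measurableType d} {P : probability T R}
  {X : nat -> {RV P >-> nat}} (X_chain : markov_chain (bd_kernel p q r) X).
Implicit Types (F : set T) (x : nat -> nat) (C : set nat).

Definition cylinder (X : nat -> {RV P >-> nat}) n x : set T :=
  [set w | forall k, (k <= n)%N -> X k w = x k].

Definition extend x n j k : nat := if (k <= n)%N then x k else j.

Lemma measurable_cylinder n x : measurable (cylinder X n x).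
Proof.
rewrite (_ : cylinder X n x =
    \bigcap_(k in [set k | (k <= n)%N]) hits X [set x k] k).
  by apply: bigcap_measurableType => k _.
by apply/seteqP; split=> w Xx k /= /Xx.
Qed.
Hint Resolve measurable_cylinder : core.

Lemma cylinder_extend n x j :
  cylinder X n.+1 (extend x n j) = cylinder X n x `&` hits X [set j] n.+1.
Proof.
rewrite /extend; apply/seteqP; split=> w /= => [Xx|[Xx Xj] k].
  split; last by have := Xx n.+1 (leqnn _); rewrite ltnn.
  by move=> k kn; have := Xx k (leqW kn); rewrite kn.
rewrite leq_eqVlt => /predU1P[->|]; first by rewrite ltnn.
by rewrite ltnS => kn; rewrite kn Xx.
Qed.

Lemma prob_extend n x j : prob P (cylinder X n.+1 (extend x n j)) =
  prob P (cylinder X n x) * bd_kernel p q r (x n) j.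
Proof.
have -> : cylinder X n x = cylinder X n (extend x n j).
  by apply/seteqP; split=> w Xx k kn; have := Xx k kn; rewrite /extend kn.
apply: EFin_inj; rewrite EFinM -!probE//.
by rewrite [LHS]X_chain /cylinder /extend leqnn ltnn.
Qed.

(* [f] is a version of the conditional probability of [F] given [X 0 .. X n]. *)
Definition markov_at (X : nat -> {RV P >-> nat}) n F f :=
  forall x, prob P (cylinder X n x `&` F) = prob P (cylinder X n x) * f (x n).

(** The event is split according to the state at time [n.+1]. The kernel gives the neighbours of [i]
    (with [i] itself) total mass 1, so every other jump is null. *)
Lemma markov_at_op n F f : measurable F ->
  markov_at X n.+1 F f -> markov_at X n F (K f).
Proof.
move=> mF Ff x; set A := cylinder X n x; set i := x n.
have mA : measurable A by exact: measurable_cylinder.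
pose H j := hits X [set j] n.+1.
have mH j : measurable (H j) by exact: measurable_hits.
have Hj j G : measurable G -> prob P (A `&` G `&` H j) =
    prob P (cylinder X n.+1 (extend x n j) `&` G).
  by rewrite cylinder_extend setIAC.
have kup : bd_kernel p q r i i.+1 = p i by rewrite /bd_kernel eqxx.
have kst : bd_kernel p q r i i = r i.
  by rewrite /bd_kernel (ltn_eqF (ltnSn i)) eqxx.
have kdn : i != 0%N -> bd_kernel p q r i i.-1 = q i.
  by case: (i) => // k _; rewrite /bd_kernel /= eqxx ltn_eqF.
have ext j : extend x n j n.+1 = j by rewrite /extend ltnn.
have split3 G : measurable G -> prob P (A `&` G) =
    prob P (cylinder X n.+1 (extend x n i.+1) `&` G) +
    prob P (cylinder X n.+1 (extend x n i) `&` G) +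
    prob P (A `&` G `\` H i.+1 `\` H i).
  move=> mG; have mAG : measurable (A `&` G) by exact: measurableI.
  rewrite (@probID _ _ _ _ _ (H i.+1))// -addrA Hj//; congr (_ + _).
  rewrite (@probID _ _ _ _ _ (H i))//; last exact: measurableD.
  congr (_ + _); rewrite -Hj//; congr (prob P _).
  apply/seteqP; split=> w; first by move=> [[]].
  move=> [AG Hi]; split=> //; split=> //; rewrite /H /hits/= => Xi.
  by move: Hi; rewrite /H /hits/= Xi; lia.
(* The mass is found by subtraction from the total, before it is known where these jumps lead. *)
have rest : prob P (A `\` H i.+1 `\` H i) = prob P A * q i.
  have := split3 setT measurableT; rewrite !setIT !prob_extend -/i kup kst -/A.
  have -> : q i = 1 - p i - r i by have := pqr1 i; lra.
  lra.
rewrite split3// !Ff !ext !prob_extend -/A -/i kup kst /bd_op !mulrDr !mulrA.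
congr (_ + _).
have mrest : measurable (A `\` H i.+1 `\` H i).
  by apply: measurableD => //; exact: measurableD.
have restF G : A `&` G `\` H i.+1 `\` H i = G `&` (A `\` H i.+1 `\` H i).
  by apply/seteqP; split=> w; [move=> [[[? ?] ?] ?]|move=> [? [[? ?] ?]]].
rewrite restF; have [i0|i0] := eqVneq i 0%N.
  have null : prob P (A `\` H i.+1 `\` H i) = 0 by rewrite rest i0 q0 mulr0.
  by rewrite prob_setI_null// i0 q0 mulr0 mul0r.
rewrite (@probID _ _ _ _ _ (H i.-1))//; last exact: measurableI.
have down G : measurable G ->
    G `&` (A `\` H i.+1 `\` H i) `&` H i.-1 = A `&` G `&` H i.-1.
  move=> mG; apply/seteqP; split=> w; first by move=> [[Gw [[Aw _] _]] Hw].
  move=> [[Aw Gw] Hw]; split=> //; split=> //.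
  by split; [split=> //|]; move: Hw i0; rewrite /H /hits /= => ->; lia.
rewrite down// Hj// Ff ext prob_extend -/i kdn// -/A.
(* The jumps to [i.-1] already carry the whole mass [q i] of the remainder. *)
suff -> : prob P (F `&` (A `\` H i.+1 `\` H i) `\` H i.-1) = 0 by rewrite addr0.
rewrite -setIDA prob_setI_null//; first exact: measurableD.
have := @probID _ _ _ P _ (H i.-1) mrest (mH _).
rewrite -{2}[A `\` _ `\` _]setTI down// Hj// setIT prob_extend -/i kdn// rest.
by rewrite -/A; lra.
Qed.

Lemma markov_at_setT n : markov_at X n setT (fun=> 1).
Proof. by move=> x; rewrite setIT mulr1. Qed.

Lemma markov_at_hits n F f C : markov_at X n F f ->
  markov_at X n (hits X C n `&` F) (fun i => \1_C i * f i).
Proof.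
move=> Ff x; rewrite indicE; have [|] := boolP (x n \in C).
  rewrite inE => Cx; rewrite mul1r -Ff setIA; congr (prob P (_ `&` _)).
  by apply/setIidl => w Xx; rewrite /hits/= Xx.
rewrite notin_setE => Cx; rewrite mul0r mulr0 setIA.
rewrite (_ : cylinder X n x `&` hits X C n = set0) ?set0I ?prob_set0//.
by rewrite -subset0 => w [Xx]; rewrite /hits/= Xx.
Qed.

Lemma markov_at_iter n N F f : measurable F ->
  markov_at X (n + N) F f -> markov_at X n F (iter N K f).
Proof.
move=> mF; elim: N f => [|N IHN] f; first by rewrite addn0.
by rewrite addnS => /(markov_at_op mF) /IHN; rewrite -iterSr.
Qed.

Lemma markov_at_hits_iter n N C :
  markov_at X n (hits X C (n + N)) (iter N K \1_C).
Proof.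
apply: markov_at_iter => //; have := markov_at_hits C (@markov_at_setT (n + N)).
by rewrite setIT (_ : (fun=> _) = \1_C)//; apply/funext => i; rewrite mulr1.
Qed.

(** The initial law being arbitrary, [F] is cut into countably many pieces by the value of [X 0],
    each of them null. *)
Lemma markov_at0_eq0 F f : measurable F -> markov_at X 0 F f ->
  (forall i, f i = 0) -> prob P F = 0.
Proof.
move=> mF Ff f0; apply/prob_eq0 => //.
have -> : F = \bigcup_i (cylinder X 0 (fun=> i) `&` F).
  apply/seteqP; split=> [w Fw|w [i _ []//]].
  by exists (X 0%N w) => //; split=> // k; rewrite leqn0 => /eqP ->.
apply/negligibleP; first by apply: bigcupT_measurable => i; exact: measurableI.
apply: negligible_bigcup => i; apply/negligibleP; first exact: measurableI.
by apply/prob_eq0; [exact: measurableI|rewrite Ff f0 mulr0].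
Qed.

(** * States reached with positive probability at a given time *)

Definition reachable (X : nat -> {RV P >-> nat}) n i :=
  exists2 x, x n = i & 0 < prob P (cylinder X n x).

Lemma reachable_start : exists i, reachable X 0 i.
Proof.
apply: contrapT => /forallNP none.
have : prob P setT = 0; last by rewrite prob_setT; apply/eqP; rewrite oner_eq0.
apply: (@markov_at0_eq0 _ (fun=> 0)) => // x.
rewrite setIT mulr0; apply/eqP; rewrite eq_le prob_ge0 andbT leNgt.
by apply/negP => x0; apply: (none (x 0%N)); exists x.
Qed.

Lemma reachable_step n i j : reachable X n i -> 0 < bd_kernel p q r i j ->
  reachable X n.+1 j.
Proof.
move=> [x <- x0] kj; exists (extend x n j); first by rewrite /extend ltnn.
by rewrite prob_extend mulr_gt0.
Qed.

(** With truncated subtraction, [(i - j) + (j - i)] is the distance from [i] to [j], which the chain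
    can cover monotonically. *)
Lemma reachable_dist n i j :
  reachable X n i -> reachable X (n + ((i - j) + (j - i))) j.
Proof.
move=> ni; have [ij|/ltnW ij] := leqP i j.
  rewrite (eqP ij) add0n; move: (j - i)%N (subnKC ij) => k <- {ij j}.
  elim: k => [|k IHk]; first by rewrite !addn0.
  rewrite !addnS; apply: (reachable_step IHk).
  by rewrite /bd_kernel eqxx.
rewrite (eqP ij) addn0; move: (i - j)%N (subnKC ij) => k.
move: ni => /[swap] <- {ij i}.
elim: k n => [|k IHk] n nj; first by rewrite !addn0 in nj *.
rewrite addnS -addSn; apply: IHk; rewrite addnS in nj.
by apply: (reachable_step nj); rewrite /bd_kernel eqxx ltn_eqF.
Qed.

(** The path passes through a state [c] with [r c > 0] and waits there until the total time is a
    multiple of [m]. *)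
Lemma reachable_multiple m i : (0 < m)%N -> exists n, reachable X (n * m) i.
Proof.
move=> m0; have [i0 Xi0] := reachable_start; have [c rc] := r_pos.
have Xc := reachable_dist c Xi0.
have Xcs s : reachable X (0 + ((i0 - c) + (c - i0)) + s) c.
  elim: s => [|s IHs]; first by rewrite addn0.
  rewrite addnS; apply: (reachable_step IHs).
  by rewrite /bd_kernel ltn_eqF// eqxx.
(* If the travel takes [D] steps in all, waiting for [D * m.-1] steps gives the total time
   [D * m]. *)
exists ((i0 - c) + (c - i0) + ((c - i) + (i - c)))%N.
have := reachable_dist i
  (Xcs (((i0 - c) + (c - i0) + ((c - i) + (i - c))) * m.-1)%N).
congr reachable; move: m0; case: m => // m _ /=.
by rewrite mulnS; lia.
Qed.

(** * Almost closed sets of the m-step chain *)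

Section StepChain.
Context {m : nat} (m_gt0 : (0 < m)%N).

Local Notation Y := (m_step m X).

Lemma markov_at_m_step n N C :
  markov_at X (n * m) (hits Y C (n + N)) (iter (N * m) K \1_C).
Proof.
have := markov_at_hits_iter (n * m) (N * m) C.
by rewrite -mulnDl.
Qed.

(* The conditional probability of [L Y C] given [Y 0 = i]. *)
Definition absorption (p q r : nat -> R) m C i : R :=
  limn (fun N => iter (N * m) (bd_op p q r) \1_C i).

Local Notation absorp := (absorption p q r m).

(** Some path of positive probability is at [i] at a multiple of [m]. Given that path, the iterates
    are the probabilities of later hits, which converge by [cvg_prob_hits]. *)
Lemma cvg_absorption C i : regular Y C ->
  iter (N * m) K \1_C i @[N --> \oo] --> absorp C i.
Proof.
move=> regC; have [n [x xi x0]] := reachable_multiple i m_gt0.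
have := cvg_prob_hits (measurable_cylinder (n * m) x) regC.
set l := prob P _; rewrite -(cvg_shiftn n) => h.
have {}h : (prob P (cylinder X (n * m) x))^-1 *
    prob P (cylinder X (n * m) x `&` hits Y C (N + n)) @[N --> \oo] -->
    (prob P (cylinder X (n * m) x))^-1 * l by apply: cvgMl_tmp; exact: h.
apply: cvgP; apply: cvg_trans h; apply: near_eq_cvg; apply: nearW => N /=.
by rewrite addnC markov_at_m_step xi mulrA mulVf ?mul1r ?gt_eqF.
Qed.

Lemma absorption_harmonic C : regular Y C ->
  forall i, iter m K (absorp C) i = absorp C i.
Proof.
move=> regC i; have cvgC j := @cvg_absorption C j regC.
have /cvg_unique := @cvg_iter_bd_op (fun N => iter (N * m) K \1_C) _ cvgC m i.
apply=> //.
rewrite /=; under eq_fun do rewrite -iterD -mulSn.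
by have := cvgC i; rewrite -(cvg_shiftS (fun N => iter (N * m) K \1_C i)).
Qed.

Lemma absorption_itv C i : regular Y C -> 0 <= absorp C i <= 1.
Proof.
move=> regC; have cvgC := cvgP _ (@cvg_absorption C i regC).
have ind j : 0 <= (\1_C j : R) <= 1.
  by rewrite indicE; case: (_ \in _); rewrite ?lexx ?ler01.
apply/andP; split.
  apply: limr_ge => //; apply: nearW => N.
  rewrite -[leLHS](iter_bd_op_cst 0 (N * m) i).
  by apply: le_iter_bd_op => j; have /andP[] := ind j.
apply: limr_le => //; apply: nearW => N.
rewrite -[leRHS](iter_bd_op_cst 1 (N * m) i).
by apply: le_iter_bd_op => j; have /andP[] := ind j.
Qed.

Lemma markov_at_L C n : regular Y C ->
  markov_at X (n * m) (L Y C) (absorp C).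
Proof.
move=> regC x.
have /cvg_unique := cvg_prob_hits (measurable_cylinder (n * m) x) regC.
apply=> //=; rewrite -(cvg_shiftn n).
rewrite /=; under eq_fun do rewrite addnC markov_at_m_step.
by apply: cvgMl_tmp; exact: cvg_absorption.
Qed.

(* A linear relation [\sum_k v k * absorption (A k) = 0] forces [v j = 0], as
   conditioning on [Y N \in A j] and letting [N] tend to infinity isolates the
   j-th term. *)
Lemma almost_closed_family l (A : 'I_l.+1 -> set nat) :
  (forall h B, (forall i, `|h i| <= B) -> (forall i, iter m K h i = h i) ->
    (forall n, (n < l)%N -> iter n K h 0%N = 0) -> forall i, h i = 0) ->
  (forall j k, j != k -> A j `&` A k = set0) ->
  ~ forall k, almost_closed Y (A k).
Proof.
move=> det dis ac; have regA k : regular Y (A k) by case: (ac k).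
(* With more rows than columns, [M] has a nonzero left kernel vector [v]; the combination [h] of the
   absorption functions with weights [v] then has vanishing initial values, so [det] applies. *)
pose M : 'M[R]_(l.+1, l) := \matrix_(k, n) iter n K (absorp (A k)) 0%N.
have : kermx M != 0.
  by rewrite -mxrank_eq0 mxrank_ker subn_eq0 -ltnNge ltnS rank_leq_col.
move=> /rowV0Pn[v /sub_kermxP vM /eqP]; apply; apply/rowP => j; rewrite mxE.
pose h i := \sum_k v ord0 k * absorp (A k) i.
have h0 i : h i = 0.
  apply: (det _ (\sum_k `|v ord0 k|)) => {i} [i|i|n nl].
  - apply: (le_trans (ler_norm_sum _ _ _)); apply: ler_sum => k _.
    have /andP[a0 a1] := absorption_itv i (regA k).
    by rewrite normrM (ger0_norm a0) ler_piMr.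
  - rewrite iter_bd_op_sum; apply: eq_bigr => k _.
    by rewrite absorption_harmonic.
  - move/rowP/(_ (Ordinal nl)): vM; rewrite !mxE => <-.
    by rewrite iter_bd_op_sum; apply: eq_bigr => k _; rewrite mxE.
pose E x N k := cylinder X 0 x `&` L Y (A k) `&` hits Y (A j) N.
have sum0 x N : \sum_k v ord0 k * prob P (E x N k) = 0.
  transitivity (prob P (cylinder X 0 x) *
      iter (N * m) K (fun i =>
        \sum_k v ord0 k * (\1_(A j) i * absorp (A k) i)) (x 0%N)).
    rewrite iter_bd_op_sum mulr_sumr; apply: eq_bigr => k _.
    rewrite mulrCA /E -setIA [L _ _ `&` _]setIC; congr (_ * _).
    apply: markov_at_iter => //; first exact: measurableI.
    by rewrite add0n; apply: markov_at_hits; exact: markov_at_L.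
  rewrite (_ : (fun i => _) = fun=> 0) ?iter_bd_op_cst ?mulr0//.
  apply/funext => i; under eq_bigr do rewrite mulrCA.
  by rewrite -mulr_sumr [X in _ * X]h0 mulr0.
have lim0 x : v ord0 j * prob P (cylinder X 0 x `&` L Y (A j)) = 0.
  have : \sum_k v ord0 k * prob P (E x N k) @[N --> \oo] -->
      \sum_k v ord0 k * prob P (cylinder X 0 x `&` L Y (A k) `&` L Y (A j)).
    apply: cvg_big => [|k _]; first exact: add_continuous.
    apply: cvgMl_tmp; apply: cvg_prob_hits => //.
    by apply: measurableI => //; exact: measurable_cylinder.
  under eq_fun do rewrite sum0.
  have /cvg_unique uniq := @norm_hausdorff _ R.
  move=> /uniq sumL; rewrite -[RHS](sumL _ (cvg_cst 0)).
  rewrite (bigD1 j)//= big1 ?addr0 => [|k kj]; first by rewrite -setIA setIid.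
  by rewrite -setIA L_disjoint ?dis// setI0 prob_set0 mulr0.
apply/eqP; apply: contraPT (ac j) => /negPf vj [_]; apply.
apply/transient_L => //.
apply: (@markov_at0_eq0 _ (fun=> 0)) => // x.
by have /eqP := lim0 x; rewrite mulf_eq0 vj => /eqP ->; rewrite mulr0.
Qed.

End StepChain.

(** * Parity classes *)

Definition parity b : set nat := [set i | odd i = b].

Lemma indic_parity b i : \1_(parity b) i = (odd i == b)%:R :> R.
Proof.
rewrite indicE; congr (_%:R); congr nat_of_bool.
by apply/idP/eqP; rewrite in_setE.
Qed.

Lemma bd_op_parity b i : K \1_(parity b) i =
  (p i + q i) * (odd i != b)%:R + r i * (odd i == b)%:R.
Proof.
rewrite /bd_op !indic_parity; case: i => [|i] /=.
  by rewrite q0; case: b => /=; ring.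
by rewrite negbK; case: (odd i); case: b => /=; ring.
Qed.

(** * Alternation of parity when the potential is bounded *)

Section BoundedPotential.
Context {B : R} (pot_le : forall n, pot n <= B).

Lemma iter_bd_op_pot_le n i : iter n K pot i <= B.
Proof.
rewrite -[leRHS](iter_bd_op_cst B n i).
exact: le_iter_bd_op.
Qed.

(** This is the expected number of self-transitions in the first [N] steps from [i]; by
    [iter_bd_op_r] the sum telescopes. *)
Lemma sum_iter_bd_op_r N i : \sum_(0 <= n < N) iter n K r i <= B.
Proof.
under eq_bigr do rewrite iter_bd_op_r.
rewrite (telescope_sumr (fun n => iter n K pot i))//.
by have := iter_bd_op_pot_le N i; have := bd_potential_ge0 i; rewrite /=; lra.
Qed.

Local Notation Y := (m_step 2 X).

(* Parity is compared rather than the states themselves because jumps by more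
   than 1 are excluded only almost surely. *)
Definition stay (X : nat -> {RV P >-> nat}) n : set T :=
  [set w | odd (X n.+1 w) = odd (X n w)].

Lemma measurable_stay n : measurable (stay X n).
Proof.
rewrite (_ : stay X n =
    \bigcup_b (hits X (parity b) n `&` hits X (parity b) n.+1)).
  by apply: fin_bigcup_measurable => // b _; exact: measurableI.
apply/seteqP; split=> w; first by exists (odd (X n w)).
by move=> [b _ []]; rewrite /hits /parity /stay/= => -> ->.
Qed.

Lemma measurable_lim_sup_stay : measurable (lim_sup_set (stay X)).
Proof.
apply: bigcap_measurableType => n _; apply: bigcup_measurable => k _.
exact: measurable_stay.
Qed.

Lemma markov_at_stay n : markov_at X n (stay X n) r.
Proof.
move=> x; rewrite (_ : _ `&` _ =
    cylinder X n x `&` hits X (parity (odd (x n))) (n + 1)).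
  rewrite markov_at_hits_iter/= bd_op_parity eqxx/=.
  by rewrite mulr0 add0r mulr1.
rewrite addn1; apply/seteqP; split=> w [Xx]; have Xn := Xx n (leqnn n);
  by rewrite /stay /hits /parity/= Xn.
Qed.

(** Borel-Cantelli, applied for each initial state separately, where [markov_at_iter] expresses the
    probabilities by [iter n K r]. *)
Lemma prob_lim_sup_stay : P (lim_sup_set (stay X)) = 0%E.
Proof.
have mst := measurable_stay; have mlim := measurable_lim_sup_stay.
apply/prob_eq0 => //; apply: (@markov_at0_eq0 _ (fun=> 0)) => // x.
have mc := measurable_cylinder 0 x.
rewrite mulr0 /lim_sup_set -bigcapIr//.
under eq_bigcapr do rewrite setI_bigcupr.
rewrite -/(lim_sup_set (fun n => cylinder X 0 x `&` stay X n)) /prob.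
rewrite lim_sup_set_cvg0//; first by move=> n; exact: measurableI.
apply: (@le_lt_trans _ _ B%:E); last exact: ltry.
apply: lime_le; first exact: is_cvg_nneseries.
apply: nearW => N.
rewrite (eq_bigr (fun n =>
    (prob P (cylinder X 0 x) * iter n K r (x 0%N))%:E)); last first.
  move=> n _; apply: (etrans (probE _)); first exact: measurableI.
  by congr (_%:E); apply: markov_at_iter; last exact: markov_at_stay.
rewrite sumEFin lee_fin -mulr_sumr.
apply: le_trans (sum_iter_bd_op_r N (x 0%N)).
rewrite ler_piMl//; first by apply: sumr_ge0 => n _; exact: iter_bd_op_ge0.
by rewrite -(@prob_setT _ _ _ P) le_prob.
Qed.

Lemma parity_eventually w : ~ lim_sup_set (stay X) w ->
  exists b, L Y (parity b) w.
Proof.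
move=> nlim.
have [N alt] : exists N, forall n, (N <= n)%N ->
    odd (X n.+1 w) = ~~ odd (X n w).
  apply: contrapT => /forallNP alt; apply: nlim => N _.
  apply: contrapT => nst; apply: (alt N) => n Nn.
  apply: contrapT => nalt; apply: nst; exists n => //.
  by rewrite /stay/=; move: nalt; case: (odd _); case: (odd _).
exists (odd (X (N * 2)%N w)); exists N => // n /= Nn.
rewrite /parity/= /m_step -(subnKC Nn); elim: (n - N)%N => [|k IHk].
  by rewrite addn0.
by rewrite addnS mulSn !addSn add0n !alt ?negbK//; lia.
Qed.

Lemma L_parityC b : L Y (parity b) `&` L Y (parity (~~ b)) = set0.
Proof.
apply: L_disjoint; rewrite -subset0 => i [].
by rewrite /parity/= => ->; case: b.
Qed.

(** Off a null event the 2-step chain settles in one parity class, and visiting [parity b]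
    infinitely often forces that class to be [parity b]. *)
Lemma regular_parity b : regular Y (parity b).
Proof.
have mUL : measurable (U Y (parity b) `\` L Y (parity b)) by exact: measurableD.
have mlim := measurable_lim_sup_stay.
apply/negligibleP => //.
apply: (negligibleS _ ((negligibleP _ mlim).2 prob_lim_sup_stay)) => w [Uw nLw].
apply: contrapT => /parity_eventually[b' Lb'].
have [bb'|] := eqVneq b b'; first by rewrite bb' in nLw.
move=> bb'; move: Lb' Uw => [N _ LN]; rewrite U_lim_sup => /(_ N I)[n /= Nn].
have := LN n Nn; rewrite /hits /parity /= => -> b'b.
by rewrite b'b eqxx in bb'.
Qed.

(** Otherwise, started at [0], the chain would be in [parity b] at times [2N] and [2N+1] with
    probabilities tending to 0. Missing the class at both times requires a self-transition, whose
    probability also tends to 0. *)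
Lemma parity_nontransient b : ~ transient Y (parity b).
Proof.
move=> /(transient_L (regular_parity b)) L0; have regb := regular_parity b.
pose f N := iter (N * 2) K \1_(parity b).
have f0 i : f N i @[N --> \oo] --> 0.
  have <- : absorption p q r 2 (parity b) i = 0; last first.
    exact: cvg_absorption.
  have [n [x <- x0]] := reachable_multiple i (isT : (0 < 2)%N).
  have := markov_at_L (isT : (0 < 2)%N) n regb x.
  rewrite prob_setI_null//.
  by move=> /esym/eqP; rewrite mulf_eq0 gt_eqF//= => /eqP.
have Kf0 : K (f N) 0%N @[N --> \oo] --> 0.
  have := @cvg_iter_bd_op f (fun=> 0) f0 1%N 0%N.
  by rewrite iter_bd_op_cst.
(* The sequence [v] is nondecreasing and bounded, so its increments tend to 0; they dominate
   [iter (N * 2) K r 0]. *)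
pose v N := iter (N * 2) K pot 0%N.
have rE N : v N.+1 = v N + iter (N * 2) K r 0%N + iter (N * 2).+1 K r 0%N.
  by rewrite /v !iter_bd_op_r mulSn !addSn add0n; ring.
have r0 n : 0 <= iter n K r 0%N by exact: iter_bd_op_ge0.
have cvgv : cvgn v.
  apply: nondecreasing_is_cvgn; last first.
    by exists B => _ [N _ <-]; exact: iter_bd_op_pot_le.
  by apply/nondecreasing_seqP => N; rewrite rE -addrA lerDl addr_ge0.
have cvgS : v N.+1 @[N --> \oo] --> limn v by rewrite (cvg_shiftS v).
have lim0 : f N 0%N + K (f N) 0%N + (v N.+1 - v N) @[N --> \oo] -->
    0 + 0 + (limn v - limn v).
  by apply: cvgD; [apply: cvgD => //; exact: f0|exact: cvgB].
suff : 1 <= 0 + 0 + (limn v - limn v) by rewrite subrr !addr0 ler10.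
apply: (cvgr_to_ge lim0); apply: nearW => N.
(* From a state of the other parity, the chain enters [parity b] with probability
   [p i + q i = 1 - r i], so the sum on the right is at least 1 everywhere. *)
have : iter (N * 2) K (fun=> 1) 0%N <=
    iter (N * 2) K (fun i => \1_(parity b) i + K \1_(parity b) i + r i) 0%N.
  apply: le_iter_bd_op => i.
  rewrite bd_op_parity indic_parity; have := pqr1 i; have := r_ge0 i.
  by case: (odd i == b) => /=; lra.
have fE : iter (N * 2) K (fun i => K \1_(parity b) i) 0%N = K (f N) 0%N.
  by rewrite -iterS iterSr.
rewrite (iter_bd_opD (fun i => \1_(parity b) i + K \1_(parity b) i)).
rewrite (iter_bd_opD \1_(parity b)) fE iter_bd_op_cst -/(f N).
by have := rE N; have := r0 (N * 2).+1; lra.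
Qed.

Lemma prob_L_parity :
  (P (L Y (parity true)) + P (L Y (parity false)) = 1)%E.
Proof.
rewrite -measureU//; last exact: (L_parityC true).
have mlim := measurable_lim_sup_stay.
have mLU : measurable (L Y (parity true) `|` L Y (parity false)).
  exact: measurableU.
apply/eqP; rewrite eq_le probability_le1//=.
have <- : P (~` lim_sup_set (stay X)) = 1%E.
  by rewrite probability_setC// prob_lim_sup_stay sube0.
apply: le_measure; rewrite ?inE//; first exact: measurableC.
by move=> w /parity_eventually[[]]; [left|right].
Qed.

(** A third disjoint set is excluded by [almost_closed_family] with [l = 2], as [h 0] and [K h 0]
    determine a function fixed by [K ^ 2]. *)
Lemma beta_2_step : beta Y = 2%:E.
Proof.
have ac b : almost_closed Y (parity b).
  by split; [exact: regular_parity|exact: parity_nontransient].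
apply: (beta_eq2 (ac true) (ac false)).
- by rewrite -subset0 => i []; rewrite /parity/= => ->.
- exact: prob_L_parity.
move=> C1 C2 C3 ac1 ac2 ac3 C12 C13 C23.
pose A (k : 'I_3) := nth set0 [:: C1; C2; C3] k.
apply: (almost_closed_family (isT : (0 < 2)%N) (A := A)).
- by move=> h b _; exact: periodic_harmonic_eq0.
- by move=> [[|[|[|//]]] ?] [[|[|[|//]]] ?] //= _; rewrite /A/= // setIC.
- by move=> [[|[|[|//]]] ?].
Qed.

End BoundedPotential.

(** Here [almost_closed_family] applies with [l = 1]: by [periodic_harmonic_origin] the value [h 0]
    determines all iterates at the origin. *)
Lemma beta_m_step_unbounded m : (0 < m)%N -> (forall b, exists n, b < pot n) ->
  beta (m_step m X) = 1%E.
Proof.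
move=> m0 potoo; apply: beta_eq1 => C1 C2 ac1 ac2 C12.
pose A (k : 'I_2) := if k == ord0 then C1 else C2.
apply: (almost_closed_family m0 (A := A)).
- move=> h B hB hm h0; apply: (periodic_harmonic_eq0 m0 hm).
  elim=> [_|n IHn nm]; first exact: h0.
  have n_m := ltnW nm.
  by rewrite (periodic_harmonic_origin potoo hB hm n_m) IHn.
- by move=> [[|[|//]] ?] [[|[|//]] ?] //= _; rewrite /A/= // setIC.
- by move=> k; rewrite /A; case: ifP.
Qed.

End BirthDeath.

(** * Divergence of the series and the equivalence *)

Lemma eseries_EFin_pinfty (R : realType) (u : nat -> R) :
  (forall n, 0 <= u n) ->
  (\sum_(0 <= j <oo) (u j)%:E = +oo)%E <->
  forall b, exists n, b < \sum_(0 <= j < n) u j.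
Proof.
move=> u0; split=> [uoo b|unb].
  apply: contrapT => /forallNP ub.
  suff : (\sum_(0 <= j <oo) (u j)%:E <= b%:E)%E by rewrite uoo leye_eq.
  apply: lime_le; first by apply: is_cvg_nneseries => n _ _; rewrite lee_fin.
  by apply: nearW => n; rewrite sumEFin lee_fin leNgt; apply/negP/ub.
apply/eqyP => b _; have [n /ltW bn] := unb b.
apply: le_trans (nneseries_lim_ge n _); last by move=> k _ _; rewrite lee_fin.
by rewrite sumEFin lee_fin.
Qed.

Theorem theorem12 (R : realType) (p q r : nat -> R)
  (p_gt0 : forall i, 0 < p i)
  (q0 : q 0%N = 0)
  (q_gt0 : forall i, 0 < q i.+1)
  (r_ge0 : forall i, 0 <= r i)
  (pqr1 : forall i, p i + q i + r i = 1)
  (r_pos : exists i, 0 < r i)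
  (d : measure_display) (T : measurableType d) (P : probability T R)
  (X : nat -> {RV P >-> nat})
  (X_chain : markov_chain (bd_kernel p q r) X) :
  asymptotically_aperiodic X <->
  (\sum_(0 <= j <oo)
     ((p j * bd_pi p q j)^-1 * \sum_(0 <= k < j.+1) r k * bd_pi p q k)%:E
   = +oo)%E.
Proof.
have term_ge0 := bd_term_ge0 p_gt0 q_gt0 r_ge0.
split=> [per1|/(eseries_EFin_pinfty term_ge0) potoo].
  apply/(eseries_EFin_pinfty term_ge0) => b.
  apply: contrapT => /forallNP pot_le.
  have /= beta2 : beta (m_step 2 X) = 2%:E.
    apply: (beta_2_step p_gt0 q0 q_gt0 r_ge0 pqr1 r_pos X_chain (B := b)) => n.
    by rewrite leNgt; apply/negP/pot_le.
  have : (2%:E <= asymptotic_period X)%E.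
    by apply: ereal_sup_ubound; exists 2%N.
  by rewrite per1 lee_fin => le21; lra.
rewrite /asymptotically_aperiodic /asymptotic_period -[RHS](ereal_sup1 1%E).
have beta1 m : (0 < m)%N -> beta (m_step m X) = 1%E.
  move=> m0.
  exact: (beta_m_step_unbounded p_gt0 q0 q_gt0 r_ge0 pqr1 r_pos X_chain m0).
(* Since every [beta] is 1, only [m = 1] satisfies [beta (m_step m X) = m]. *)
congr ereal_sup; apply/seteqP; split=> [_ [m [m0 betam] <-]|_ ->].
  by rewrite /= -betam beta1.
by exists 1%N => //; split=> //; rewrite beta1.
Qed.
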